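(* Let $A \in \mathcal M_d(\mathbb R)$ and let $\tau$ be a delay function such that $\inf_{s \in [0, t]} \tau(s) > 0$ for every $t \geq 0$. Let $\mathbf n\colon \mathbb R \to \mathbb N$ be the associated function counting iterations. If $x$ is a solution of $$x(t) = A x(t - \tau(t)), \qquad t \geq 0,$$ with initial condition $x_0$, then $$x(t) = A^{\mathbf n(t)} x_0(\sigma_{\mathbf n(t)}(t)) \qquad \text{for every } t \in \mathbb R_+.$$
   Context: $\mathbb R_+ = [0, +\infty)$, $\mathbb R_+^\ast = (0, +\infty)$, $\mathbb N = \{0, 1, 2, \dots\}$; $\mathcal M_d(\mathbb R)$ is the set of real $d \times d$ matrices, $d$ a positive integer. For $a \leq b$ in $\mathbb R \cup \{\pm\infty\}$, $\lvert a, b)$ denotes $[a, b)$ if $a > -\infty$ and $(a, b)$ if $a = -\infty$. A \emph{delay function} is any function $\tau\colon \mathbb R_+ \to \mathbb R_+^\ast$. Its \emph{largest delay function} is $h\colon \mathbb R_+ \to \mathbb R_+^\ast \cup \{+\infty\}$, $h(t) = t - \inf_{s \in [t, +\infty)} (s - \tau(s))$. A \emph{solution} of the equation is a function $x\colon \lvert -h(0), +\infty) \to \mathbb R^d$ such that $x(t) = A x(t - \tau(t))$ for every $t \in \mathbb R_+$; its \emph{initial condition} $x_0$ is its restriction to $\lvert -h(0), 0)$. Iterated delay functions $\sigma_n\colon D_n \to \mathbb R$: $D_0 = \mathbb R$, $\sigma_0(t) = t$, and, for $n \geq 1$, $D_n = \{t \in \mathbb R_+ \mid t - \tau(t) \in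 D_{n-1}\}$ and $\sigma_n(t) = \sigma_{n-1}(t - \tau(t))$ for $t \in D_n$. Under the condition $\inf_{[0,t]} \tau > 0$ for every $t \geq 0$, there is a unique function $\mathbf n\colon \mathbb R \to \mathbb N$ such that $t \in D_{\mathbf n(t)} \setminus D_{\mathbf n(t) + 1}$ for every $t \in \mathbb R$, and one has $\sigma_{\mathbf n(t)}(t) \in \lvert -h(0), 0)$ for every $t \in \mathbb R_+$. *)

(* Defs.v *)
From HB Require Import structures.
From mathcomp Require Import all_boot all_order all_algebra.
From mathcomp Require Import all_classical all_reals.
From mathcomp Require Import ereal.

Set Implicit Arguments.
Unset Strict Implicit.
Unset Printing Implicit Defensive.

Import Order.TTheory GRing.Theory Num.Theory.
Local Open Scope classical_set_scope.
Local Open Scope ring_scope.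

Section DelayFunctions.
Variable R : realType.
Implicit Types (tau : R -> R) (a b : \bar R).

(* The real interval |a, b), i.e. [a, b) if a is finite and (a, b) if a = -oo:
   the large inequality covers both cases, since the elements are real. *)
Definition left_interval a b : set R := [set s | (a <= s%:E < b)%E].

(* Functions defined on a part of R are total here; only their values on that
   part are constrained or used. In particular tau is relevant on [0, +oo). *)
Definition delay_function tau : Prop := forall t, 0 <= t -> 0 < tau t.

Definition largest_delay tau (t : R) : \bar R :=
  (t%:E - ereal_inf [set (s - tau s)%:E | s in `[t, +oo[])%E.

(* x is relevant on |-h(0), +oo), which contains t - tau t for all t >= 0. *)
Definition solution (d : nat) (A : 'M[R]_d) tau (x : R -> 'cV[R]_d) : Prop :=
  forall t, 0 <= t -> x t = A *m x (t - tau t).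

(* x0 is relevant on |-h(0), 0), where it coincides with x. *)
Definition initial_condition (d : nat) tau (x x0 : R -> 'cV[R]_d) : Prop :=
  forall s, left_interval (- largest_delay tau 0)%E 0%E s -> x0 s = x s.

Fixpoint iter_domain tau (n : nat) : set R :=
  if n is m.+1 then [set t | 0 <= t /\ iter_domain tau m (t - tau t)]
  else setT.

(* sigma_n, relevant on iter_domain tau n. *)
Fixpoint iter_delay tau (n : nat) (t : R) : R :=
  if n is m.+1 then iter_delay tau m (t - tau t) else t.

(* The n with t in D_n \ D_(n+1). Such an n exists and is unique when tau is a
   delay function with positive infimum on every [0, t]; 0 is a default value
   otherwise. *)
Definition iter_count tau (t : R) : nat :=
  xget 0%N [set n | (iter_domain tau n `\` iter_domain tau n.+1) t].

End DelayFunctions.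

(* Main.v *)
Require Import Defs.
From HB Require Import structures.
From mathcomp Require Import all_boot all_order all_algebra.
From mathcomp Require Import all_classical all_reals.
From mathcomp Require Import ereal.

Import Order.TTheory GRing.Theory Num.Theory.
Local Open Scope classical_set_scope.
Local Open Scope ring_scope.

(** Unfolding the equation along the iterates gives [x t = A^n x (sigma_n t)]
    for every [t] in [D_n]. The iterates of [t >= 0] that stay nonnegative lie
    in [[0, t]], so each step decreases them by at least [inf_[0,t] tau > 0];
    hence they become negative after finitely many steps, and [n(t)] is the
    first step at which this happens. At that step the iterate is of the form
    [s - tau s] with [s >= 0], hence at least [-h(0)]. *)

(** [iter_delay] recurses through its first step, which moves the base point; peeling off the last
    step keeps [t] fixed, as the decay estimate requires. *)
Lemma iter_delayS (R : realType) (tau : R -> R) (n : nat) (t : R) :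
  iter_delay tau n.+1 t = iter_delay tau n t - tau (iter_delay tau n t).
Proof. by elim: n t => [//|n IHn] t; rewrite [LHS]IHn. Qed.

Lemma iter_domainS (R : realType) (tau : R -> R) (n : nat) (t : R) :
  iter_domain tau n.+1 t <-> iter_domain tau n t /\ 0 <= iter_delay tau n t.
Proof.
elim: n t => [|n IHn] t; first by split=> -[].
split=> [[t0 /IHn[Dn sn]]|[[t0 Dn] sn]]; first by [].
by split=> //; apply/IHn.
Qed.

Lemma solution_iter (R : realType) (d : nat) (A : 'M[R]_d) (tau : R -> R)
    (x : R -> 'cV[R]_d) (n : nat) (t : R) :
  solution A tau x -> iter_domain tau n t ->
  x t = A ^+ n *m x (iter_delay tau n t).
Proof.
move=> hx; elim: n t => [|n IHn] t /= => [_|[t0 Dn]].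
  by rewrite expr0 mul1mx.
by rewrite hx // IHn // mulmxA exprS.
Qed.

(** The bound on [tau] applies at every iterate before the last: each is nonnegative and, by
    induction and [0 <= m], at most [t]. *)
Lemma iter_delay_le (R : realType) (tau : R -> R) (m t : R) (n : nat) :
  0 <= m -> (forall s, 0 <= s <= t -> m <= tau s) ->
  iter_domain tau n t -> iter_delay tau n t <= t - m *+ n.
Proof.
move=> m0 hm; elim: n => [_|n IHn /iter_domainS[/IHn len s0]].
  by rewrite subr0.
rewrite iter_delayS mulrSr opprD addrA lerB // hm // s0 /=.
by rewrite (le_trans len) // gerBl mulrn_wge0.
Qed.

Lemma iter_countP (R : realType) (tau : R -> R) (t : R) :
  delay_function tau -> 0 <= t -> 0 < inf [set tau s | s in `[0, t]] ->
  (iter_domain tau (iter_count tau t) `\`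
   iter_domain tau (iter_count tau t).+1) t.
Proof.
move=> htau t0 m0; set m := inf _ in m0.
suff [n Dn] : exists n, (iter_domain tau n `\` iter_domain tau n.+1) t.
  exact: (@xgetPex _ 0%N [set n | (iter_domain tau n `\` iter_domain tau n.+1) t]
    (ex_intro _ n Dn)).
apply: contrapT => noD.
have D n : iter_domain tau n t.
  elim: n => [//|n Dn]; apply: contrapT => nDn; apply: noD.
  by exists n.
have hm s : 0 <= s <= t -> m <= tau s.
  move=> st; apply: ge_inf; last by exists s => //=; rewrite in_itv.
  (* A real [inf] bounds from below only sets that have a lower bound; positivity of [tau] provides
     0. *)
  exists 0 => _ [u /= + <-]; rewrite in_itv /= => /andP[u0 _].
  exact/ltW/htau.
have [/= k tk] : exists k, t < m *+ k.
  exists (Num.bound (t / m)); rewrite -mulr_natr mulrC -ltr_pdivrMr //.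
  by rewrite archi_boundP // divr_ge0 // ltW.
(* The index is [k.+1] because the domain of index [k] says nothing on the sign of the [k]-th
   iterate. *)
have /iter_domainS[Dk sk] := D k.+1.
have := le_trans sk (@iter_delay_le _ _ _ _ _ (ltW m0) hm Dk).
by rewrite subr_ge0 leNgt tk.
Qed.

Lemma iter_delay_left_interval (R : realType) (tau : R -> R) (n : nat) (t : R) :
  0 <= t -> (iter_domain tau n `\` iter_domain tau n.+1) t ->
  left_interval (- largest_delay tau 0)%E 0%E (iter_delay tau n t).
Proof.
move=> t0 [Dn nDn]; apply/andP; split; last first.
  by rewrite lte_fin ltNge; apply/negP => sn; apply: nDn; apply/iter_domainS.
(* The case [n = 0] is void: [0 <= t] already puts [t] in the domain of index 1. So the iterate has
   a nonnegative predecessor. *)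
case: n Dn nDn => [_ []|n /iter_domainS[_ sn] _]; first by split.
rewrite /largest_delay sub0e oppeK iter_delayS; apply: ereal_inf_lbound.
by exists (iter_delay tau n t) => //=; rewrite in_itv /= sn.
Qed.

Theorem theorem4p11 (R : realType) (d : nat) (hd : (0 < d)%N)
  (A : 'M[R]_d) (tau : R -> R)
  (htau : delay_function tau)
  (hinf : forall t : R, 0 <= t -> 0 < inf [set tau s | s in `[0, t]])
  (x x0 : R -> 'cV[R]_d)
  (hx : solution A tau x)
  (hx0 : initial_condition tau x x0) :
  forall t : R, 0 <= t ->
    x t = A ^+ iter_count tau t *m x0 (iter_delay tau (iter_count tau t) t).
Proof.
move=> t t0; have D := @iter_countP _ _ _ htau t0 (hinf t t0).
rewrite hx0; last exact: iter_delay_left_interval.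
by apply: solution_iter => //; case: D.
Qed.
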